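(* Let $n\geq 4$ be an integer and let $H_n$ be the graph with vertex set $\{v_{i,j} : i\in\{0,\dots,n-1\},\ j\in\mathbb Z_3\}$ in which $v_{i,j}v_{i,j'}$ is an edge for all $i$ and all $j\neq j'$, $v_{i,j}v_{i+1,j}$ is an edge for all $0\leq i\leq n-2$ and $j\in\mathbb Z_3$, and $v_{0,j}v_{n-1,-j}$ is an edge for all $j\in\mathbb Z_3$ (and there are no other edges). Then for every subset $W\subseteq V(H_n)$, the graph $H_n^{(W)}$ obtained from $H_n$ by replicating $W$ is not $5$-critical.
   Context: All graphs are simple (no loops, no parallel edges). Replicating a vertex $w$ of a graph $G$ means adding a new vertex $w'$ (the clone of $w$) adjacent to $w$ and to all neighbours of $w$. Replicating a set $W\subseteq V(G)$ means replicating each vertex of $W$ in sequence (only vertices of the original $W$ are replicated, not clones); the result, denoted $G^{(W)}$, does not depend on the order. A graph is $k$-chromatic if its chromatic number is $k$, and $k$-critical if it is $k$-chromatic and $G-v$ is $(k-1)$-colourable for every vertex $v$. Equivalently, $H_n$ is the Cartesian product of the path on $\{0,\dots,n-1\}$ with the complete graph $K_3$ on $\mathbb Z_3$, plus the three edges joining $(0,j)$ to $(n-1,-j)$; it is $4$-critical. *)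

(* Defs.v *)
From mathcomp Require Import all_boot all_algebra.

Set Implicit Arguments.
Unset Strict Implicit.
Unset Printing Implicit Defensive.

Record sgraph := SGraph {
  vertex :> finType;
  adj : rel vertex;
  adj_sym : symmetric adj;
  adj_irr : irreflexive adj }.

Section FromEdges.
Variables (T : finType) (r : rel T).

Definition simple_adj : rel T := fun x y => (x != y) && (r x y || r y x).

Lemma simple_adj_sym : symmetric simple_adj.
Proof. by move=> x y; rewrite /simple_adj eq_sym orbC. Qed.

Lemma simple_adj_irr : irreflexive simple_adj.
Proof. by move=> x; rewrite /simple_adj eqxx. Qed.

Definition graph_of_edges := SGraph simple_adj_sym simple_adj_irr.
End FromEdges.

Section Deletion.
Variables (G : sgraph) (v : G).

Definition delete_adj : rel {x : G | x != v} :=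
  fun x y => adj (val x) (val y).

Lemma delete_adj_sym : symmetric delete_adj.
Proof. by move=> x y; exact: adj_sym. Qed.

Lemma delete_adj_irr : irreflexive delete_adj.
Proof. by move=> x; exact: adj_irr. Qed.

Definition delete_vertex := SGraph delete_adj_sym delete_adj_irr.
End Deletion.

Section Replication.
Variables (G : sgraph) (w : G).

(* [None] is the clone of [w]; [Some u] is the original vertex [u]. *)
Definition replicate_adj : rel (option G) := fun x y =>
  match x, y with
  | Some u, Some v => adj u v
  | Some u, None | None, Some u => (u == w) || adj w u
  | None, None => false
  end.

Lemma replicate_adj_sym : symmetric replicate_adj.
Proof. by case=> [x|] [y|] //=; exact: adj_sym. Qed.

Lemma replicate_adj_irr : irreflexive replicate_adj.
Proof. by case=> [x|] //=; exact: adj_irr. Qed.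

Definition replicate := SGraph replicate_adj_sym replicate_adj_irr.
End Replication.

(* [f] sends each vertex of the original graph to itself seen as a vertex of
   the current graph, so that clones are never replicated. *)
Fixpoint replicate_seq (T : Type) (G : sgraph) (f : T -> G) (s : seq T) :
    sgraph :=
  if s is w :: s' then
    replicate_seq (fun x : T => Some (f x) : replicate (f w)) s'
  else G.

(* Up to isomorphism the order in which [W] is enumerated is irrelevant. *)
Definition replicate_set (G : sgraph) (W : {set G}) : sgraph :=
  replicate_seq (fun x : G => x) (enum W).

Definition colourable (G : sgraph) (k : nat) : bool :=
  [exists c : {ffun G -> 'I_k},
    [forall x : G, [forall y : G, adj x y ==> (c x != c y)]]].

Lemma colourable_ex (G : sgraph) : exists k, colourable G k.
Proof.
exists #|G|; apply/existsP; exists [ffun x => enum_rank x].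
apply/forallP=> x; apply/forallP=> y; apply/implyP=> xy.
rewrite !ffunE (inj_eq enum_rank_inj).
by apply: contraTneq xy => ->; rewrite adj_irr.
Qed.

Definition chromatic_number (G : sgraph) : nat := ex_minn (colourable_ex G).

Definition critical (k : nat) (G : sgraph) : Prop :=
  chromatic_number G = k /\
  forall v : G, colourable (delete_vertex v) k.-1.

(* One orientation of each edge; [graph_of_edges] symmetrises it. The index
   [j] ranges over Z/3Z, and [- x.2] is negation there. *)
Definition H_edge (n : nat) : rel ('I_n * 'Z_3) := fun x y =>
  [|| (x.1 == y.1) && (x.2 != y.2),
      (x.1.+1 == y.1 :> nat) && (x.2 == y.2)
    | [&& x.1 == 0 :> nat, y.1 == n.-1 :> nat & y.2 == (- x.2)%R]].

(* For [n >= 2] the removal of loops in [graph_of_edges] has no effect here. *)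
Definition H_graph (n : nat) : sgraph := graph_of_edges (@H_edge n).

(* Main.v *)
Require Import Defs.
From mathcomp Require Import all_boot zmodp zify.

(** A 4-colouring of the replicated graph gives two colours to each replicated
    vertex and one to every other vertex. If some triangle contains two
    replicated vertices, it becomes a K5 that survives the deletion of a vertex
    elsewhere. If an odd cycle missing some vertex has at most one vertex that
    is not replicated, then going around it the colour pairs alternate between a
    2-set and its complement, so the cycle is not 4-colourable, again after the
    deletion of a vertex elsewhere. In all other cases the graph is
    4-colourable: we may assume that every triangle has exactly one replicated
    vertex, so that the replicated set is a word over the columns {0, 1, 2}, and
    a finite automaton, which propagates the set of colourings of the last
    triangle that are compatible with a fixed colouring of the first, shows that
    the cycle of triangles can be closed up unless the word is one of those
    excluded above. *)

Set Implicit Arguments.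
Unset Strict Implicit.
Unset Printing Implicit Defensive.

(** * An automaton reading words over the three columns *)

(* A colouring of a layer is the sequence of the colours of columns 0, 1, 2
   followed by the colour of the clone. *)
Definition layer_colourings : seq (seq nat) := permutations (iota 0 4).

(* In [(t, s)], [t] is the column of the replicated vertex of a layer and [s] a
   colouring of that layer. *)
Definition compat (p q : nat * seq nat) : bool :=
  [&& all (fun j => nth 0 p.2 j != nth 0 q.2 j) (iota 0 3),
      nth 0 p.2 3 != nth 0 q.2 p.1,
      nth 0 p.2 q.1 != nth 0 q.2 3
    & (p.1 == q.1) ==> (nth 0 p.2 3 != nth 0 q.2 3)].

(* The column [- j] of Z/3Z. *)
Definition negc j := (3 - j) %% 3.

Definition changes (t : nat) (w : seq nat) : nat :=
  count id (pairmap (fun a b => a != b) t w).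

(* [state] summarises a nonempty word over {0, 1, 2}: its length [l] up to
   parity once [4 <= l], its number of nonzero letters capped at 2, whether 0
   occurs, its number of changes of letter capped at 2, its last letter, and the
   colourings of the last layer that are compatible with the colouring
   [iota 0 4] of the first one. *)
Definition state : Type := nat * nat * bool * nat * nat * seq (seq nat).

Definition length_class l := if l < 5 then l else if odd l then 5 else 4.

Definition init (t : nat) : state :=
  (1, (t != 0) : nat, t == 0, 0, t, [:: iota 0 4]).

Definition next (q : state) (u : nat) : state :=
  let: (l, nz, z, ch, t, A) := q in
  (length_class l.+1, minn 2 (nz + (u != 0)), z || (u == 0),
   minn 2 (ch + (t != u)), u,
   [seq b <- layer_colourings | has (fun a => compat (t, a) (u, b)) A]).

(* Seen from the last layer, through the edges between columns [j] and [- j],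
   the colouring [iota 0 4] of the first layer reads [[:: 0; 2; 1; 3]]. *)
Definition accepting (t0 : nat) (q : state) : bool :=
  let: (l, nz, z, ch, t, A) := q in
  [|| l < 4, if odd l then nz < 2 else ~~ z && (ch < 2)
    | has (fun b => compat (t, b) (negc t0, [:: 0; 2; 1; 3])) A].

(* One round of breadth-first search; the second component is the frontier. *)
Definition expand (LF : seq state * seq state) : seq state * seq state :=
  let F := [seq q <- undup [seq next q u | q <- LF.2, u <- iota 0 3]
              | q \notin LF.1] in
  (F ++ LF.1, F).

Definition states (t0 : nat) : seq state :=
  (iter 11 expand ([:: init t0], [:: init t0])).1.

(** Closure under [next] is tested here, so the number of search rounds in [states] needs no
    separate justification. *)
Lemma states_check :
  all (fun t0 => let L := states t0 in
         [&& init t0 \in L, all (accepting t0) L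
           & all (fun q => all (fun u => next q u \in L) (iota 0 3)) L])
      (iota 0 3).
Proof. by vm_compute. Qed.

Lemma word_accepting (t : nat) (w : seq nat) :
  all (fun u => u < 3) (t :: w) -> accepting t (foldl next (init t) w).
Proof.
case/andP=> lt_t3 /allP w3.
have t_in : t \in iota 0 3 by rewrite mem_iota.
have /and3P[init_in /allP accL /allP nextL] := (elimT allP states_check) t t_in.
apply: accL; elim/last_ind: w w3 => //= w u IHw w3.
rewrite -cats1 foldl_cat /=.
have /IHw/nextL/allP nextw : forall v, v \in w -> v < 3.
  by move=> v vw; apply: w3; rewrite mem_rcons inE vw orbT.
by apply: nextw; rewrite mem_iota /= w3 // mem_rcons mem_head.
Qed.

Lemma changes_rcons t w u :
  changes t (rcons w u) = changes t w + (last t w != u).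
Proof. by rewrite /changes -cats1 pairmap_cat count_cat /= addn0. Qed.

Lemma length_classS l : length_class (length_class l).+1 = length_class l.+1.
Proof.
rewrite /length_class; have [//|le_5l] := ltnP l 5.
have ->: l.+1 < 5 = false by lia.
by rewrite /=; case: (odd l).
Qed.

Arguments length_class : simpl never.

(** Soundness of the automaton: filtering by [has] leaves each colouring a compatible predecessor,
    so a chain can be traced back to the first layer. *)
Lemma foldl_next t w :
  exists A, foldl next (init t) w =
      (length_class (size w).+1, minn 2 (count (predC1 0) (t :: w)),
       0 \in t :: w, minn 2 (changes t w), last t w, A)
  /\ forall b, b \in A -> exists s,
      [/\ unzip1 s = w, path compat (t, iota 0 4) s,
          last (t, iota 0 4) s = (last t w, b)
        & all (mem layer_colourings) (unzip2 s)].
Proof.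
elim/last_ind: w => [|w u [A [def_q pathA]]].
  exists [:: iota 0 4]; split.
    by rewrite /init /= addn0 inE (eq_sym 0); case: (t == 0).
  by move=> b; rewrite inE => /eqP->; exists [::].
rewrite foldl_rcons {}def_q /next; eexists; split.
  rewrite length_classS size_rcons last_rcons; congr (_, _, _, _, _, _).
  - rewrite -[in RHS]cats1 -cat_cons count_cat [count _ [:: u]]/= addn0; lia.
  - by rewrite -rcons_cons mem_rcons inE orbC (eq_sym u).
  - rewrite changes_rcons; lia.
move=> b; rewrite mem_filter => /andP[/hasP[a aA ab] b_lc].
have [s [s1 s_path s_last s2]] := pathA a aA.
exists (rcons s (u, b)); split.
- by rewrite /unzip1 map_rcons -/unzip1 -s1.
- by rewrite rcons_path s_path s_last.
- by rewrite !last_rcons.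
- by rewrite /unzip2 map_rcons all_rcons andbC; apply/andP.
Qed.

(** The words ruled out are those whose replicated vertices fill an odd cycle up to one vertex:
    column 0 for an odd number of layers, otherwise a cycle in columns 1 and 2 that switches column
    once. *)
Definition colourable_word (w : seq nat) : bool :=
  if odd (size w) then 1 < count (predC1 0) w
  else (0 \in w) || (1 < changes (head 0 w) (behead w)).

Lemma word_colouring (t : nat) (w : seq nat) :
    all (fun u => u < 3) (t :: w) -> 3 <= size w -> colourable_word (t :: w) ->
  exists s, [/\ unzip1 s = w, path compat (t, iota 0 4) s,
    all (mem layer_colourings) (unzip2 s)
    & compat (last (t, iota 0 4) s) (negc t, [:: 0; 2; 1; 3])].
Proof.
move=> w3 le3w good; have := word_accepting w3.
have [A [-> pathA]] := foldl_next t w.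
(* A state is accepted because the word is short, because it is excluded, or because the cycle
   closes up; the hypotheses refute the first two. *)
case/or3P => [lt4|bad|/hasP[b bA b_closed]].
- by move: lt4; rewrite /length_class; do 2?case: ifP; lia.
- move: good bad; rewrite /colourable_word [size _]/=.
  have ->: odd (length_class (size w).+1) = odd (size w).+1.
    rewrite /length_class; case: ifP => // _; by case: (odd (size w).+1).
  case: ifP => _; first by lia.
  by move=> /orP[-> //|]; rewrite [behead _]/= [head _ _]/= => ? /andP[_]; lia.
- by have [s [s1 s_path s_last s2]] := pathA b bA; exists s; rewrite s_last.
Qed.

(** * Replication described inside [G * bool] *)

(* [(x, false)] stands for the vertex [x] and [(x, true)] for its clone. *)
Definition rep_adj (G : sgraph) : rel (G * bool) :=
  fun p q => (p != q) && ((p.1 == q.1) || adj p.1 q.1).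

Definition rep_mem (G : sgraph) (W : {set G}) : pred (G * bool) :=
  fun p => p.2 ==> (p.1 \in W).

(** [h] embeds [R] as an induced subgraph of the strong product of [G] with an edge, which replaces
    the nested option types of iterated replication. *)
Definition is_replication (G : sgraph) (W : {set G}) (R : sgraph)
    (h : R -> G * bool) : Prop :=
  [/\ injective h, forall p, (exists u, h u = p) <-> rep_mem W p
    & forall u v, adj u v = rep_adj (h u) (h v)].

Lemma rep_adj_sym (G : sgraph) : symmetric (@rep_adj G).
Proof. by move=> p q; rewrite /rep_adj eq_sym (eq_sym p.1) adj_sym. Qed.

Lemma replicate_is_replication (G R : sgraph) (W : {set G}) (h : R -> G * bool)
    (w : G) (w' : R) :
    w \notin W -> is_replication W h -> h w' = (w, false) ->
  is_replication (w |: W) (fun u : replicate w' => oapp h (w, true) u).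
Proof.
move=> wW [h_inj h_im h_adj] hw'.
have hS u : h u != (w, true).
  apply/eqP=> hu; have /h_im : exists u, h u = (w, true) by exists u.
  by rewrite /rep_mem /= (negPf wW).
have adj_w' u : (u == w') || adj w' u = rep_adj (h u) (w, true).
  rewrite /rep_adj hS h_adj /rep_adj -(inj_eq h_inj) hw' /= adj_sym.
  by case: eqVneq => [->|_]; rewrite ?eqxx //= (eq_sym w).
split.
- move=> [u|] [v|] //=; first by move=> /h_inj->.
    by move/eqP; rewrite (negPf (hS u)).
  by move/esym/eqP; rewrite (negPf (hS v)).
- move=> [x b]; rewrite /rep_mem /= in_setU1; split.
    case=> [[u|]] /=; last by case=> <- <-; rewrite eqxx.
    move=> hu; have /h_im : exists u, h u = (x, b) by exists u.
    by rewrite /rep_mem /=; case: b {hu} => //= ->; rewrite orbT.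
  case: (eqVneq x w) => [->|_] /=.
    by case: b => _; [exists None|exists (Some w')].
  by move=> /(proj2 (h_im (x, b))) [u hu]; exists (Some u).
- move=> [u|] [v|] /=.
  + by rewrite h_adj.
  + exact: adj_w'.
  + by rewrite adj_w' rep_adj_sym.
  + by rewrite /rep_adj eqxx.
Qed.

Lemma replicate_seq_is_replication (G R : sgraph) (W : {set G})
    (h : R -> G * bool) (f : G -> R) (s : seq G) :
    uniq s -> {in s, forall x, x \notin W} -> is_replication W h ->
    (forall x, h (f x) = (x, false)) ->
  exists h', @is_replication G (W :|: [set x in s]) (replicate_seq f s) h'.
Proof.
elim: s R W h f => [|w s IHs] R W h f /=.
  have <-: W = W :|: [set x in [::]] by apply/setP=> x; rewrite !inE orbF.
  by exists h.
case/andP=> ws s_uniq sW repW hf.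
have wW : w \notin W by apply: sW; rewrite mem_head.
have [] := IHs _ _ _ (fun x => Some (f x) : replicate (f w)) s_uniq _
             (replicate_is_replication wW repW (hf w)).
- move=> x xs; rewrite in_setU1 negb_or sW ?inE ?xs ?orbT // andbT.
  by apply: contraNneq ws => <-.
- exact: hf.
have ->: w |: W :|: [set x in s] = W :|: [set x in w :: s].
  by apply/setP=> x; rewrite !inE orbCA orbA.
by move=> h'; exists h'.
Qed.

Lemma replicate_set_is_replication (G : sgraph) (W : {set G}) :
  exists h, @is_replication G W (replicate_set W) h.
Proof.
have rep0 : @is_replication G set0 G (fun x => (x, false)).
  split=> [x y [] //|[x b]|x y]; rewrite ?/rep_mem ?/rep_adj /=.
    rewrite in_set0; split=> [[u [_ <-]] //|]; case: b => // _; by exists x.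
  rewrite xpair_eqE eqxx andbT.
  by case: eqVneq => [->|//]; rewrite adj_irr.
have [|//|h] :=
    replicate_seq_is_replication (f := fun x : G => x) (enum_uniq W) _ rep0.
  by move=> x; rewrite in_set0.
by rewrite set0U set_enum; exists h.
Qed.

Lemma colourableP (G : sgraph) k :
  reflect (exists c : G -> 'I_k, forall x y, adj x y -> c x != c y)
          (colourable G k).
Proof.
apply: (iffP existsP) => [[c /forallP cP]|[c cP]].
  by exists c => x y; move/forallP/(_ y)/implyP: (cP x).
exists [ffun x => c x]; apply/forallP=> x; apply/forallP=> y.
by apply/implyP=> xy; rewrite !ffunE cP.
Qed.

Lemma colourable_replication (G R : sgraph) (W : {set G}) (h : R -> G * bool)
    (k : nat) (c : G * bool -> 'I_k) :
    is_replication W h ->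
    {in rep_mem W &, forall p q, rep_adj p q -> c p != c q} ->
  colourable R k.
Proof.
move=> [_ h_im h_adj] cP; apply/colourableP; exists (c \o h) => u v.
rewrite h_adj; apply: cP; apply/h_im; by [exists u|exists v].
Qed.

(** Only the original copy of [v] is deleted; the conditions [p.1 != v] and [q.1 != v] set its
    possible clone aside as well. *)
Lemma colourable_delete_vertex (G R : sgraph) (W : {set G})
    (h : R -> G * bool) (v : G) (k : nat) :
    is_replication W h ->
    (forall u : R, colourable (delete_vertex u) k.+1) ->
  exists c : G * bool -> 'I_k.+1,
    {in rep_mem W &, forall p q, p.1 != v -> q.1 != v -> rep_adj p q ->
       c p != c q}.
Proof.
move=> [h_inj h_im h_adj] colR.
have [u hu] : exists u, h u = (v, false) by apply/h_im.
have /colourableP[c cP] := colR u.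
(* The default [ord0] is taken only at the deleted vertex and, in the witness below, outside the
   image of [h]. *)
pose d (x : R) := oapp c ord0 (insub x : option {x : R | x != u}).
exists (fun p => oapp d ord0 [pick x | h x == p]) => p q.
move=> /h_im[x <-] /h_im[y <-] xv yv xy.
have pickE z : [pick x | h x == h z] = Some z.
  case: pickP => [z' /eqP/h_inj->//|/(_ z)]; by rewrite eqxx.
have neq_u z : (h z).1 != v -> z != u.
  by apply: contraNneq => ->; rewrite hu.
rewrite !pickE /= /d (insubT (fun z => z != u) (neq_u _ xv)).
rewrite (insubT (fun z => z != u) (neq_u _ yv)) /=; apply: cP.
by rewrite /= /delete_adj /= h_adj.
Qed.

(** * Obstructions: large cliques and odd cycles *)

Section Obstructions.
Variables (G R : sgraph) (W : {set G}) (h : R -> G * bool).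
Hypothesis repR : is_replication W h.

Lemma noncolourable_clique (v : G) (k : nat) (K : seq (G * bool)) :
    uniq K -> all (rep_mem W) K -> all (fun p => p.1 != v) K ->
    {in K &, forall p q, (p.1 == q.1) || adj p.1 q.1} -> k.+1 < size K ->
  ~ (forall u : R, colourable (delete_vertex u) k.+1).
Proof.
move=> K_uniq /allP KW /allP Kv Kadj ltkK.
case/(colourable_delete_vertex v repR)=> c cP.
suff: uniq (map c K).
  move/card_uniqP; rewrite size_map => cardK.
  by have := max_card (mem (map c K)); rewrite cardK card_ord leqNgt ltkK.
rewrite map_inj_in_uniq // => p q pK qK eq_c; apply/eqP/idPn=> neq_pq.
have := cP p q (KW p pK) (KW q qK) (Kv p pK) (Kv q qK).
by rewrite /rep_adj neq_pq Kadj // eq_c eqxx => /(_ isT).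
Qed.

(* Around the cycle the colour pairs of the replicated vertices alternate
   between a 2-set and its complement in the four colours, so that both
   neighbours of [x] together use all four colours. *)
Lemma noncolourable_odd_cycle_head (v x : G) (s : seq G) :
    cycle (@adj G) (x :: s) -> ~~ odd (size s) -> {subset s <= W} ->
    v \notin x :: s ->
  ~ (forall u : R, colourable (delete_vertex u) 4).
Proof.
case: s => [|y s] /=; first by rewrite adj_irr.
rewrite negbK rcons_path => /and3P[xy s_path sx] s_odd sW vs.
case/(colourable_delete_vertex v repR)=> c cP.
have neq_v z : z \in x :: y :: s -> z != v by apply: contraTneq => ->.
have memW z b : z \in y :: s -> (z, b) \in rep_mem W.
  by move=> zs; apply/implyP=> _; apply: sW.
have neq_cons z : z \in y :: s -> z != v.
  by move=> zs; rewrite neq_v // in_cons zs orbT.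
pose Q z := [set c (z, false); c (z, true)].
have cardQ z : z \in y :: s -> #|Q z| = 2.
  move=> zs; rewrite cards2 cP ?memW ?neq_cons //.
  by rewrite /rep_adj eqxx andbT xpair_eqE eqxx.
have adjQ z b z' : z \in x :: y :: s -> b ==> (z \in W) -> z' \in y :: s ->
    adj z z' -> c (z, b) \notin Q z'.
  move=> zs zW zs' zz'.
  have neq_zz' : z != z' by apply: contraTneq zz' => ->; rewrite adj_irr.
  suff c_neq b' : c (z, b) != c (z', b') by rewrite !inE negb_or !c_neq.
  apply: cP; [exact: zW|exact: memW|exact: neq_v|exact: neq_cons|].
  by rewrite /rep_adj xpair_eqE (negPf neq_zz') zz' orbT.
(* Adjacent replicated vertices have disjoint colour pairs, and two disjoint pairs exhaust four
   colours. *)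
have complQ z z' : z \in y :: s -> z' \in y :: s -> adj z z' -> Q z' = ~: Q z.
  move=> zs zs' zz'; apply/eqP; rewrite eqEcard; apply/andP; split.
    have z's : z' \in x :: y :: s by rewrite in_cons zs' orbT.
    apply/subsetP=> a; rewrite !inE => /orP[]/eqP->; rewrite -in_set2 -/(Q z);
      by apply: adjQ; rewrite // ?sW // adj_sym.
  by have := cardsC (Q z); rewrite cardQ // cardQ // card_ord; lia.
have lastQ s1 s2 : s = s1 ++ s2 ->
    Q (last y s1) = if odd (size s1) then ~: Q y else Q y.
  elim/last_ind: s1 s2 => [//|s1 z IHs1] s2; rewrite cat_rcons => def_s.
  have := s_path; rewrite def_s cat_path /= => /and3P[_ zz _].
  rewrite last_rcons size_rcons /= (complQ _ _ _ _ zz) ?(IHs1 _ def_s).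
  - by case: odd => //=; rewrite setCK.
  - by rewrite def_s -cat_cons mem_cat mem_last.
  - by rewrite def_s in_cons mem_cat mem_head !orbT.
have := lastQ s [::]; rewrite cats0 s_odd => /(_ erefl) Qlast.
have : c (x, false) \notin Q (last y s).
  by apply: adjQ; rewrite ?mem_head ?mem_last // adj_sym.
rewrite Qlast in_setC negbK; apply/negP.
by apply: adjQ; rewrite ?mem_head.
Qed.

(** A rotation brings the vertex outside [W], if there is one, to the head. *)
Lemma noncolourable_odd_cycle (v : G) (s : seq G) :
    cycle (@adj G) s -> odd (size s) -> count (fun x => x \notin W) s <= 1 ->
    v \notin s ->
  ~ (forall u : R, colourable (delete_vertex u) 4).
Proof.
move=> s_cyc s_odd s_W vs.
have [i [x [s1 [def_s s1W]]]] : exists i x s1,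
    rot i s = x :: s1 /\ {subset s1 <= W}.
  have [/hasP[x xs xW]|] := boolP (has (fun x => x \notin W) s).
    have [i s1 def_s] := rot_to xs; exists i, x, s1; split=> // y ys.
    apply/idPn=> yW; move: s_W; rewrite leqNgt => /negP[].
    have /seq.permP <- : perm_eq (rot i s) s by rewrite perm_rot.
    rewrite def_s /= xW ltnS -has_count.
    by apply/hasP; exists y.
  case: s s_odd {s_cyc s_W vs} => [//|x s1] _ /hasPn sW.
  exists 0, x, s1; rewrite rot0; split=> // y ys.
  by have := sW y; rewrite inE ys orbT negbK; apply.
apply: (@noncolourable_odd_cycle_head v x s1) => //.
- by rewrite -def_s rot_cycle.
- by have := size_rot i s; rewrite def_s => eq_s; move: s_odd; rewrite -eq_s.
- by rewrite -def_s mem_rot.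
Qed.
End Obstructions.

(** * Words with few changes, and compatibility vertex by vertex *)

Lemma changes_eq0 x w : changes x w = 0 -> w = nseq (size w) x.
Proof.
elim: w x => [//|y w IHw] x; rewrite /changes /=; case: eqVneq => // -> /=.
by move/IHw => {1}->.
Qed.

(** Among the letters 1 and 2, the one other than [x] is [3 - x]. *)
Lemma changes_le1 x w :
    all (fun u => 0 < u < 3) (x :: w) -> changes x w <= 1 ->
  exists a b, x :: w = nseq a.+1 x ++ nseq b (3 - x).
Proof.
elim: w => [|y w IHw] /=; first by exists 0, 0.
case/and3P=> x3 y3 w3; rewrite /changes /=; case: eqVneq => [<- /=|neq_xy].
  case/IHw; first by rewrite /= x3.
  by move=> a [b def_w]; exists a.+1, b; rewrite def_w.
rewrite add1n ltnS leqn0 => /eqP/changes_eq0 def_w.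
have <-: y = 3 - x by lia.
by exists 0, (size w).+1; rewrite /= -def_w.
Qed.

(** A flag that is set selects the clone, at position 3, in place of column [j], which must then be
    the replicated one. *)
Lemma compat_neq t a u b j (p q : bool) :
    compat (t, a) (u, b) -> j < 3 -> (p -> j = t) -> (q -> j = u) ->
  nth 0 a (if p then 3 else j) != nth 0 b (if q then 3 else j).
Proof.
case/and4P=> /allP abP /= at_neq ub_neq ab3 j3 pj qj.
case: p q pj qj => [] [] pj qj.
- by apply: (implyP ab3); rewrite -pj // -qj.
- by rewrite pj.
- by rewrite qj.
- by apply: abP; rewrite mem_iota.
Qed.

(** * Coordinates and cycles in [H_graph m.+1] *)

Section Prism.
Variable m : nat.
Hypothesis m_gt2 : 2 < m.
Local Notation H := (H_graph m.+1).

Definition vert (i j : nat) : H := (inord i, inord j).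

Lemma vert_ord (x : H) : vert x.1 x.2 = x.
Proof. by case: x => i j; rewrite /vert /= !inord_val. Qed.

Lemma H_adjE (x y : H) :
  adj x y = (x != y) && (H_edge x y || H_edge y x).
Proof. by []. Qed.

Lemma vert_eq i j i' j' : i <= m -> i' <= m -> j < 3 -> j' < 3 ->
  (vert i j == vert i' j') = (i == i') && (j == j').
Proof.
move=> im i'm j3 j'3; rewrite /vert xpair_eqE.
by rewrite -!(inj_eq val_inj) /= !inordK.
Qed.

Lemma adj_vert_row i j : i < m -> j < 3 -> adj (vert i j) (vert i.+1 j).
Proof.
move=> im j3; rewrite H_adjE vert_eq ?(ltnW im) // ltn_eqF //=.
by rewrite /H_edge /= !inordK ?ltnS ?(ltnW im) // !eqxx orbT.
Qed.

Lemma adj_vert_layer i j j' : i <= m -> j < 3 -> j' < 3 -> j != j' ->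
  adj (vert i j) (vert i j').
Proof.
move=> im j3 j'3 jj'; rewrite H_adjE vert_eq // eqxx jj' /=.
by rewrite /H_edge /= eqxx -(inj_eq val_inj) /= !inordK // jj'.
Qed.

Lemma adj_vert_wrap j : j < 3 -> adj (vert m j) (vert 0 (negc j)).
Proof.
move=> j3; have nj3 : negc j < 3 by rewrite ltn_mod.
rewrite H_adjE vert_eq // gtn_eqF ?(ltn_trans _ m_gt2) //=.
apply/orP; right; apply/or3P/Or33/and3P; split; rewrite /= ?inordK //.
rewrite -(inj_eq val_inj) /= !inordK //.
by move: j j3 {nj3} => [|[|[]]].
Qed.

Lemma path_column i j l : i + l <= m -> j < 3 ->
  path (@adj H) (vert i j) [seq vert k j | k <- iota i.+1 l].
Proof.
move=> + j3; elim: l i => [//|l IHl] i il.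
by apply/andP; split; [apply: adj_vert_row|apply: IHl]; lia.
Qed.

Lemma last_column i j l :
  last (vert i j) [seq vert k j | k <- iota i.+1 l] = vert (i + l) j.
Proof.
by elim: l i => [|l IHl] i /=; rewrite ?addn0 // IHl addSnnS.
Qed.

(** Negation fixes 0, so column 0 closes up by itself. *)
Lemma cycle_column0 : cycle (@adj H) [seq vert k 0 | k <- iota 0 m.+1].
Proof.
rewrite [cycle _ _]/= rcons_path path_column // last_column.
exact: (adj_vert_wrap (j := 0)).
Qed.

(** Negation exchanges columns 1 and 2, so one switch, at layer [a], closes the cycle; its length is
    [m.+2]. *)
Lemma cycle_columns a j : a <= m -> 0 < j < 3 ->
  cycle (@adj H) ([seq vert k j | k <- iota 0 a.+1] ++
                  [seq vert k (3 - j) | k <- iota a (m - a).+1]).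
Proof.
move=> am /andP[j0 j3].
have j'3 : 3 - j < 3 by lia.
rewrite [cycle _ _]/= rcons_path cat_path path_column // last_cat.
rewrite last_column add0n last_cons last_column subnKC // andTb.
apply/andP; split.
  apply/andP; split; first by apply: adj_vert_layer => //; lia.
  by apply: path_column => //; rewrite subnKC.
have := adj_vert_wrap j'3; congr (adj _ (vert 0 _)).
by move: j j0 j3 {j'3} => [|[|[]]].
Qed.

(** * Criticality constrains the word; the word gives a colouring *)

Section Replicated.
Variables (W : {set H}) (R : sgraph) (h : R -> H * bool).
Hypothesis repR : is_replication W h.

Definition colourable_deletions := forall u : R, colourable (delete_vertex u) 4.

(** A layer together with two clones is a K5; [v] is taken in another layer. *)
Lemma layer_le1 :
  colourable_deletions -> {in W &, forall x y, x.1 = y.1 -> x = y}.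
Proof.
move=> crit x y xW yW xy1; apply/eqP/idPn=> neq_xy.
pose v : H := (if x.1 == ord0 then ord_max else ord0, ord0).
have neq_v : x.1 != v.1.
  rewrite /v /=; case: (eqVneq x.1 ord0) => [->|//].
  by rewrite -(inj_eq val_inj) eq_sym -lt0n ltnW // ltnW.
pose K := [:: (x, true); (y, true)] ++
          [seq ((x.1, j) : H, false) | j <- enum 'Z_3].
have K1 p : p \in K -> p.1.1 = x.1.
  by rewrite !inE => /or3P[/eqP->|/eqP->|/mapP[j _ ->]].
apply: (noncolourable_clique (v := v) (K := K) repR _ _ _ _ _ crit).
- rewrite cat_uniq; apply/and3P; split.
  + by rewrite /= inE xpair_eqE (negPf neq_xy).
  + by apply/hasPn=> p /mapP[j _ ->]; rewrite !inE !xpair_eqE !andbF.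
  + by rewrite map_inj_uniq ?enum_uniq // => j j' [].
- rewrite all_cat /= /rep_mem /= xW yW /=.
  by apply/allP=> p /mapP[j _ ->].
- apply/allP=> p /K1 p1; apply: contraNneq neq_v => <-.
  by rewrite p1.
- move=> p q /K1 p1 /K1 q1; have [//|neq_pq] := eqVneq p.1 q.1.
  rewrite orFb H_adjE neq_pq /H_edge p1 q1 eqxx.
  suff ->: p.1.2 != q.1.2 by [].
  apply: contraNneq neq_pq => pq2.
  by rewrite [p.1]surjective_pairing p1 pq2 -q1 -surjective_pairing.
- by rewrite size_cat size_map -cardE card_ord.
Qed.

(* The column of the replicated vertex of layer [k]; a layer without one may be
   treated as if it had one, in a column chosen to keep the word colourable. *)
Definition letter (k : nat) : nat :=
  if vert k 1 \in W then 1 else if vert k 2 \in W then 2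
  else if (vert k 0 \in W) || odd m then 0 else 1.

Lemma letter_lt3 k : letter k < 3.
Proof. by rewrite /letter; do 3?case: ifP. Qed.

Lemma word_colourable :
  colourable_deletions -> colourable_word (mkseq letter m.+1).
Proof.
move=> crit; rewrite /colourable_word size_mkseq /=.
case: ifP => m_odd.
  rewrite ltnNge; apply/negP=> few.
  apply: (noncolourable_odd_cycle (v := vert 0 1) repR cycle_column0 _ _ _
            crit).
  - by rewrite size_map size_iota.
  (* Here [m] is even and the filler letter is 1, so a letter 0 means that column 0 is replicated in
     that layer. *)
  - apply: leq_trans few.
    rewrite -[_ + _]/(count (predC1 0) (mkseq letter m.+1)) !count_map.
    apply: sub_count => k /=; apply: contraNneq.
    by rewrite /letter (negPf m_odd) orbF; do 3?case: ifP.
  - apply/mapP=> [[k]]; rewrite mem_iota ltnS => km /eqP.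
    by rewrite vert_eq // andbF.
apply/idPn; rewrite negb_or -leqNgt => /andP[no0 ch].
have letter12 k : k <= m -> 0 < letter k < 3.
  move=> km; rewrite letter_lt3 andbT lt0n; apply: contraNneq no0 => <-.
  by apply: (map_f letter); rewrite mem_iota.
have [|a [b def_w]] := changes_le1 _ ch.
  apply/allP=> _ /(mapP (s := iota 0 m.+1))[k + ->].
  by rewrite mem_iota => /letter12.
have ab : a + b = m.
  have := congr1 size def_w.
  by rewrite size_cat !size_nseq /= size_map size_iota => -[].
have letterE k : k <= m -> letter k = if k <= a then letter 0 else 3 - letter 0.
  move=> km; have := congr1 (fun s => nth 0 s k) def_w.
  rewrite -[letter 0 :: _]/(mkseq letter m.+1) nth_mkseq // nth_cat size_nseq.
  rewrite !nth_nseq ltnS => ->; have [//|ka] := leqP k a.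
  by have -> : k - a.+1 < b by lia.
(* Here [m] is odd and the filler letter is 0, which does not occur, so every letter marks a
   replicated vertex. *)
have letterW k : k <= m -> vert k (letter k) \in W.
  move/letter12; rewrite /letter; do 3?case: ifP => //.
  by rewrite (negbFE m_odd) orbT.
have am : a <= m by lia.
have l0 := letter12 0 isT.
apply: (noncolourable_odd_cycle (v := vert 0 0) repR (cycle_columns am l0) _ _
          _ crit).
- rewrite size_cat !size_map !size_iota addSn addnS subnKC //=.
  by rewrite negbK (negbFE m_odd).
- rewrite count_cat !count_map.
  rewrite (@eq_in_count _ _ pred0) ?count_pred0 => [|k]; last first.
    rewrite mem_iota => /andP[_ ka] /=; apply/negbTE; rewrite negbK.
    by have := letterW k; rewrite letterE ?(leq_trans _ am) // -ltnS ka; apply.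
  (* After the switch, only the vertex of layer [a] may lie outside [W]. *)
  rewrite add0n /= (@eq_in_count _ _ pred0) ?count_pred0 => [|k]; last first.
    rewrite mem_iota => /andP[ak km] /=; apply/negbTE; rewrite negbK.
    have km' : k <= m by rewrite -ltnS (leq_trans km) // addSn subnKC.
    by have := letterW k km'; rewrite letterE // leqNgt ak.
  by rewrite addn0 leq_b1.
- rewrite mem_cat; apply/orP=> [[]] /mapP[k];
    by rewrite mem_iota => /andP[k1 k2] /eqP; rewrite vert_eq //; lia.
Qed.

Lemma replication_colourable :
    {in W &, forall x y, x.1 = y.1 -> x = y} ->
    colourable_word (mkseq letter m.+1) ->
  colourable R 4.
Proof.
move=> one good.
have letterP (x : H) : x \in W -> x.2 = letter x.1 :> nat.
  move=> xW.
  have uniq_col j : j < 3 -> vert x.1 j \in W -> x.2 = j :> nat.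
    move=> j3 /(one _ _ xW) ->; first by rewrite /= inordK.
    by rewrite /= inord_val.
  rewrite /letter; case: ifP => [/uniq_col->//|x1].
  case: ifP => [/uniq_col->//|x2].
  have x20 : x.2 = 0 :> nat.
    move: xW x1 x2; rewrite -{1}(vert_ord x).
    by case: (x.2) => [[|[|[]]]] //= _ ->.
  have -> : vert x.1 0 \in W by move: xW; rewrite -{1}(vert_ord x) x20.
  exact: x20.
have [||s [s1 s_path s_lc s_closed]] := word_colouring _ _ good.
- by apply/allP=> _ /(mapP (s := iota 0 m.+1))[k _ ->]; apply: letter_lt3.
- by rewrite size_map size_iota.
have size_s : size s = m by have := congr1 size s1; rewrite !size_map size_iota.
pose ps := (letter 0, iota 0 4) :: s.
pose col k := (nth (0, [::]) ps k).2.
have ps1 k : k <= m -> nth (0, [::]) ps k = (letter k, col k).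
  move=> km; rewrite [LHS]surjective_pairing; congr (_, _).
  have ps1E : map fst ps = mkseq letter m.+1.
    by rewrite /= -[map fst s]/(unzip1 s) s1.
  by rewrite -(nth_map _ 0 fst) ?ps1E ?nth_mkseq //= size_s.
have step k : k < m -> compat (letter k, col k) (letter k.+1, col k.+1).
  move=> km; rewrite -!ps1 ?(ltnW km) //.
  by apply: (pathP _ s_path); rewrite size_s.
have closed : compat (letter m, col m) (negc (letter 0), [:: 0; 2; 1; 3]).
  by rewrite -ps1 // -[m in nth _ _ m]size_s -[size s]/((size ps).-1) nth_last.
have colP k : k <= m -> perm_eq (col k) (iota 0 4).
  case: k => [|k] km; first exact: perm_refl.
  rewrite -mem_permutations; apply: (allP s_lc).
  by rewrite /col /= -(nth_map _ [::] snd) ?mem_nth ?size_map ?size_s.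
have col_lt k j : k <= m -> j < 4 -> nth 0 (col k) j < 4.
  move=> km j4; have := colP k km => ck.
  have: nth 0 (col k) j \in iota 0 4.
    by rewrite -(perm_mem ck) mem_nth // (perm_size ck).
  by rewrite mem_iota.
pose pos (p : H * bool) : nat := if p.2 then 3 else p.1.2.
have pos_lt4 p : pos p < 4.
  by rewrite /pos; case: p.2 => //; apply: leq_trans (ltn_ord _) _.
pose c (p : H * bool) : 'I_4 := inord (nth 0 (col p.1.1) (pos p)).
have c_val p : c p = nth 0 (col p.1.1) (pos p) :> nat.
  by rewrite inordK // col_lt // -ltnS.
have cE (p q : H * bool) :
    nth 0 (col p.1.1) (pos p) != nth 0 (col q.1.1) (pos q) ->
    (c p != c q) && (c q != c p).
  by rewrite -!(inj_eq val_inj) /= !c_val eq_sym => ->.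
have memW (p : H * bool) :
    p \in rep_mem W -> p.2 -> p.1.2 = letter p.1.1 :> nat.
  by move=> /implyP pW /pW/letterP.
(* Within a layer, colours differ because [col k] is a permutation and distinct vertices have
   distinct positions. *)
have c_layer (p q : H * bool) : p \in rep_mem W -> q \in rep_mem W -> p != q ->
    p.1.1 = q.1.1 -> c p != c q.
  move=> pW qW neq_pq eq1; have km : p.1.1 <= m by rewrite -ltnS.
  suff /cE/andP[] : nth 0 (col p.1.1) (pos p) != nth 0 (col q.1.1) (pos q).
    by [].
  have ck := colP _ km.
  rewrite -eq1 nth_uniq ?(perm_size ck) ?(perm_uniq ck) ?pos_lt4 //.
  apply: contraNneq neq_pq => eq_pos; apply/eqP.
  move: (memW p pW) (memW q qW) eq_pos eq1; rewrite /pos.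
  case: p q {pW qW km ck} => [[i j] b] [[i' j'] b'] /=.
  case: b b' => [] [] /= pj qj eq_pos eq1.
  - rewrite eq1 in pj *; congr (_, _, _).
    by apply: val_inj; rewrite /= pj // qj.
  - by have := ltn_ord j'; rewrite -eq_pos.
  - by have := ltn_ord j; rewrite eq_pos.
  - by congr (_, _, _) => //; apply: val_inj.
have c_edge (p q : H * bool) :
    p \in rep_mem W -> q \in rep_mem W -> p.1 != q.1 ->
    H_edge p.1 q.1 -> (c p != c q) && (c q != c p).
  move=> pW qW neq_pq /or3P[/andP[/eqP eq1 _]|/andP[/eqP eq1 /eqP eq2]|].
  - have neq : p != q by apply: contraNneq neq_pq => ->.
    by rewrite !c_layer // eq_sym.
  - apply: cE; rewrite /pos -eq1 -eq2; apply: compat_neq; first apply: step.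
    + by rewrite -ltnS eq1 ltn_ord.
    + exact: ltn_ord.
    + exact: memW.
    + by rewrite eq1 eq2; apply: memW.
  case/and3P=> /eqP p0 /eqP qm /eqP q2; rewrite andbC; apply: cE.
  have j_eq : q.1.2 = negc p.1.2 :> nat by rewrite q2.
  have qP : q.2 -> q.1.2 = letter m :> nat by move/(memW q qW); rewrite qm.
  have pP : p.2 -> q.1.2 = negc (letter 0) :> nat.
    by move/(memW p pW); rewrite j_eq p0 => ->.
  have := compat_neq closed (ltn_ord _) qP pP.
  have ->: nth 0 [:: 0; 2; 1; 3] (if p.2 then 3 else q.1.2) =
      nth 0 (col 0) (pos p).
    rewrite /pos j_eq; case: p.2 => //.
    by case: (p.1.2) => [[|[|[]]]].
  by rewrite qm p0.
apply: (colourable_replication (c := c) repR) => p q pW qW /andP[neq_pq].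
case: (eqVneq p.1 q.1) => [eq1 _|neq1]; first by rewrite c_layer // eq1.
rewrite H_adjE neq1 /= => /orP[] pq.
  by case/andP: (c_edge _ _ pW qW neq1 pq).
by rewrite eq_sym in neq1; case/andP: (c_edge _ _ qW pW neq1 pq).
Qed.

End Replicated.
End Prism.

Theorem theorem2p1 (n : nat) (hn : 4 <= n) (W : {set H_graph n}) :
  ~ critical 5 (replicate_set W).
Proof.
case: n hn W => [//|m] m_gt2 W [chi5 crit].
have [h repR] := replicate_set_is_replication W.
have: colourable (replicate_set W) 4.
  exact: (replication_colourable m_gt2 repR (layer_le1 m_gt2 repR crit)
            (word_colourable m_gt2 repR crit)).
move: chi5; rewrite /chromatic_number; case: ex_minnP => k _ k_min k5 /k_min.
by rewrite k5.
Qed.
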